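(* Let $n>1$ be a square-free integer, let $\mathcal{O}$ be the ring of algebraic integers in $\mathbb{Q}(\sqrt n)$, and let $L$ be the lattice underlying $\mathcal{O}$ (at the scale where $1$ has norm $1$). Let $k$ be a fixed square root $\sqrt n$ of $n$, let $\alpha_0=-1$, let $C$ be the chamber of the Weyl group $W(L)$ containing $k$ and having $\alpha_0$ as a simple root, and let $\alpha$ be the other simple root of $C$. Let $u$ be a fundamental unit for $\mathcal{O}$, and set $v=u$ or $v=u^2$ according to whether $u$ has (field) norm $1$ or $-1$. Suppose $u$ is chosen so that $v$ has positive trace, and negative inner product with $k$. Then $\alpha$ is the smallest positive multiple of $1+v$ that lies in $\mathcal{O}$.
   Context: The lattice $L$ is $\mathcal{O}$ as an abelian group with the $\mathbb{Q}$-valued inner product $x\cdot y=\frac12\mathrm{Tr}(x\bar y)$, where the bar is Galois conjugation, so that the lattice norm $x^2:=x\cdot x$ equals the field norm $x\bar x$; explicitly $(a+b\sqrt n)\cdot(c+d\sqrt n)=ac-nbd$. It has signature $(1,1)$. A root of $L$ is a primitive $\alpha\in L$ (i.e. $L/\langle\alpha\rangle$ is torsion-free) with $\alpha\cdot\alpha>0$ and $\alpha\cdot L\subseteq\frac{\alpha\cdot\alpha}{2}\mathbb{Z}$; $W(L)$ is the group generated by the reflections $x\mapsto x-2\frac{x\cdot\alpha}{\alpha\cdot\alpha}\alpha$ in all roots. Hyperbolic $1$-space $H^1$ is the image of the negative-norm vectors in the projectivization of $L\otimes\mathbb{R}$; the future cone is the one containing $k$, and points are represented by future-directed vectors. A chamber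 of $W(L)$ is the closure in $H^1\cup\partial H^1$ of a component of the complement of all mirrors of reflections in $W(L)$. A simple root of a chamber is a root orthogonal to one of its facets (here: endpoints) and having negative inner product with vectors in its interior (simple roots are outward-pointing). ''Multiple'' means multiple by a rational (equivalently real) scalar. *)

(* Defs.v *)
From HB Require Import structures.
From mathcomp Require Import all_boot all_order all_algebra.
From mathcomp Require Import generic_quotient.
From mathcomp Require Import all_classical all_reals all_analysis.
From mathcomp Require Import ring.

Set Implicit Arguments.
Unset Strict Implicit.
Unset Printing Implicit Defensive.

Import Order.TTheory GRing.Theory Num.Theory.
Import numFieldNormedType.Exports.

Local Open Scope classical_set_scope.
Local Open Scope ring_scope.
Local Open Scope quotient_scope.

Definition squarefree (n : nat) : Prop :=
  forall d : nat, (d ^ 2 %| n)%N -> d = 1%N.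

(* The F-algebra F[X]/(X^2 - n): the pair (a, b) stands for a + b k, where
   k is a square root of n.  For F = rat and n > 1 square-free this is the
   field Q(sqrt n); for F = R real it is Q(sqrt n) (x) R.  The alias shields
   it from the componentwise ring structure of F * F. *)
Definition quad (n : nat) (F : Type) : Type := (F * F)%type.

Section QuadAlgebra.
Variables (n : nat) (F : numFieldType).
Local Notation Q := (quad n F).

HB.instance Definition _ := GRing.Lmodule.copy Q (F^o * F^o)%type.

Definition quad_one : Q := (1, 0).
Definition quad_mul (x y : Q) : Q :=
  (x.1 * y.1 + n%:R * (x.2 * y.2), x.1 * y.2 + x.2 * y.1).

Let pairP (x y : Q) : x.1 = y.1 -> x.2 = y.2 -> x = y.
Proof. by case: x y => [a b] [c d] /= -> ->. Qed.

Let quad_mulA : associative quad_mul.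
Proof. by move=> x y z; apply: pairP => /=; ring. Qed.
Let quad_mulC : commutative quad_mul.
Proof. by move=> x y; apply: pairP => /=; ring. Qed.
Let quad_mul1 : left_id quad_one quad_mul.
Proof. by move=> x; apply: pairP => /=; ring. Qed.
Let quad_mulD : left_distributive quad_mul +%R.
Proof. by move=> x y z; apply: pairP => /=; ring. Qed.
Let quad_one_neq0 : quad_one != 0.
Proof. by apply/eqP => -[] /eqP; rewrite oner_eq0. Qed.

HB.instance Definition _ := GRing.Zmodule_isComNzRing.Build Q
  quad_mulA quad_mulC quad_mul1 quad_mulD quad_one_neq0.

Definition qsqrt : Q := (0, 1).

Definition qconj (x : Q) : Q := (x.1, - x.2).

(* x + qconj x and x * qconj x lie in F, that is, have second coordinate 0. *)
Definition qtrace (x : Q) : F := (x + qconj x).1.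
Definition qnorm (x : Q) : F := (x * qconj x).1.

Definition dot (x y : Q) : F := qtrace (x * qconj y) / 2.

Let qnormE (x : Q) : qnorm x = x.1 ^+ 2 - n%:R * x.2 ^+ 2.
Proof. by rewrite /qnorm /=; ring. Qed.

Definition quad_unit : pred Q := fun x => qnorm x != 0.
Definition quad_inv (x : Q) : Q :=
  if qnorm x == 0 then x else (qnorm x)^-1 *: qconj x.

Let quad_mulV : {in quad_unit, left_inverse 1 quad_inv *%R}.
Proof.
move=> x; rewrite -topredE /= /quad_unit /quad_inv => nx0; rewrite (negPf nx0).
move: nx0; rewrite qnormE => nx0.
by apply: pairP; rewrite /= /GRing.scale /=; field.
Qed.

Let quad_unitP (x y : Q) : y * x = 1 -> quad_unit x.
Proof.
move=> yx1; apply/eqP => nx0.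
have : qnorm (y * x) = qnorm y * qnorm x by rewrite !qnormE /=; ring.
rewrite yx1 nx0 mulr0 qnormE /= expr0n mulr0 subr0 expr1n.
by move/eqP; rewrite oner_eq0.
Qed.

Let quad_inv_out : {in [predC quad_unit], quad_inv =1 id}.
Proof. by move=> x; rewrite inE negbK /quad_inv => ->. Qed.

HB.instance Definition _ := GRing.ComNzRing_hasMulInverse.Build Q
  quad_mulV quad_unitP quad_inv_out.

Lemma qsqrt_sqr : qsqrt ^+ 2 = n%:R.
Proof.
have natE m : (m%:R : Q) = (m%:R, 0).
  by elim: m => // m IHm; rewrite !mulrS IHm; apply: pairP => /=; ring.
by rewrite natE; apply: pairP => /=; ring.
Qed.

Lemma dotE (x y : Q) : dot x y = x.1 * y.1 - n%:R * (x.2 * y.2).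
Proof. by rewrite /dot /qtrace /=; field. Qed.

Lemma dot_qnorm (x : Q) : dot x x = qnorm x.
Proof. by rewrite dotE qnormE; ring. Qed.

Definition reflection (b x : Q) : Q := x - (2 * (dot x b / dot b b)) *: b.

End QuadAlgebra.

Arguments qsqrt {n F}.

HB.instance Definition _ (n : nat) (R : realType) :=
  Topological.copy (quad n R) (R * R)%type.

Section Lattice.
Variable n : nat.
Local Notation K := (quad n rat).

Definition ringO : set K := [set x | integralOver (fun m : int => m%:~R) x].

Definition primitive (a : K) : Prop :=
  forall (x : K) (m : int), ringO x -> m != 0 ->
    (exists j : int, x *~ m = a *~ j) -> exists j : int, x = a *~ j.

Definition lattice_root (a : K) : Prop :=
  [/\ ringO a, primitive a, 0 < dot a a &
      forall x, ringO x -> exists m : int, dot a x = dot a a / 2 * m%:~R].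

Definition unitO (u : K) : Prop := ringO u /\ exists2 w, ringO w & u * w = 1.

Definition fundamental_unit (u : K) : Prop :=
  unitO u /\ forall w, unitO w -> exists m : int, w = u ^ m \/ w = - u ^ m.

Definition smallest_positive_multiple (x a : K) : Prop :=
  exists c : rat, [/\ 0 < c, a = c *: x, ringO a &
    forall c' : rat, 0 < c' -> ringO (c' *: x) -> c <= c'].

End Lattice.

Section Hyperbolic.
Variables (n : nat) (R : realType).
Local Notation V := (quad n R).

Definition toV (x : quad n rat) : V := (ratr x.1, ratr x.2).

Definition nonzero : set V := [set x | x != 0].

Definition same_line (x y : nonzero) : bool :=
  `[< exists2 c : R, c != 0 & \val y = c *: \val x >].

Let same_line_refl : reflexive same_line.
Proof. by move=> x; apply/asboolP; exists 1; rewrite ?oner_eq0 ?scale1r. Qed.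

Let same_line_imp x y : same_line x y -> same_line y x.
Proof.
move=> /asboolP[c c0 yE]; apply/asboolP; exists c^-1; first by rewrite invr_eq0.
by rewrite yE scalerA mulVf ?scale1r.
Qed.

Let same_line_sym : symmetric same_line.
Proof. by move=> x y; apply/idP/idP; apply: same_line_imp. Qed.

Let same_line_trans : transitive same_line.
Proof.
move=> y x z /asboolP[c c0 yE] /asboolP[d d0 zE]; apply/asboolP.
by exists (d * c); rewrite ?mulf_neq0 // zE yE scalerA.
Qed.

Canonical same_line_equiv :=
  EquivRel same_line same_line_refl same_line_sym same_line_trans.

Definition projV : Type := quotient_topology {eq_quot same_line_equiv}.
HB.instance Definition _ := Topological.on projV.
HB.instance Definition _ := Quotient.on projV.

Definition proj (X : set V) : set projV :=
  [set \pi_projV x | x in [set x : nonzero | X (\val x)]].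

Definition representatives (S : set projV) : set V :=
  [set \val x | x in [set x : nonzero | S (\pi_projV x)]].

Definition H1 : set projV := proj [set x | dot x x < 0].
Definition bdH1 : set projV := proj [set x | dot x x = 0].

Definition future : set V :=
  connected_component [set x : V | dot x x < 0] qsqrt.

(* Root reflections are involutions, so this is the group they generate. *)
Inductive weyl : (V -> V) -> Prop :=
| weyl_id : weyl id
| weyl_refl a : lattice_root a -> weyl (reflection (toV a))
| weyl_comp g h : weyl g -> weyl h -> weyl (g \o h).

Definition mirror (b : V) : set projV := proj [set x | dot x b = 0].

Definition mirrors : set projV :=
  \bigcup_(b in [set b : V | dot b b != 0 /\ weyl (reflection b)]) mirror b.

Definition chamber (C : set projV) : Prop :=
  exists2 p, (H1 `\` mirrors) p &
    C = closure (connected_component (H1 `\` mirrors) p) `&` (H1 `|` bdH1).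

Definition endpoint (C : set projV) : set projV := C `\` interior C.

Definition simple_root (C : set projV) (a : quad n rat) : Prop :=
  [/\ lattice_root a, exists2 p, endpoint C p & mirror (toV a) p &
      forall x, future x -> representatives (interior C) x ->
        dot (toV a) x < 0].

End Hyperbolic.

(* Main.v *)
Require Import Defs.
From HB Require Import structures.
From mathcomp Require Import all_boot all_order all_algebra.
From mathcomp Require Import generic_quotient algC algnum.
From mathcomp Require Import all_classical all_reals all_analysis.
From mathcomp Require Import ring lra zify.

(** For a root [a] the reflection in [a] is [x |-> - (a / qconj a) * qconj x].
Since it preserves the lattice, [w = a / qconj a] is a unit of norm 1, and
[1 + w = qtrace a / qconj a] is a rational multiple of [a] ([root_unit]).
Conversely, for every unit [w] of norm 1 with [0 < w.1], the primitive multiple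
of [1 + w] is a root ([root_of_norm_one], [exists_primitive_multiple]).  So the
roots correspond, up to sign, to the powers of [v]: norm-one units are [v ^ i]
or [- v ^ i] ([fundamental_power]), and those of positive trace with positive
second coordinate are the [v ^ i] with [0 < i] ([positive_power]).

A point of [H1] is written [pt t], the class of [(t, 1)], with [t ^ 2 < n].
The mirror of [-1] is at [t = 0], and the mirror of [1 + v ^ i] moves away from
it as [i] grows; [mirror_order] says that the one of [1 + v] comes strictly
before the one of [1 + v ^ i] for [1 < i].

The geometry enters through one principle: a connected subset of [H1] that
misses a mirror lies on one side of it ([connected_side]), so a chamber lies
weakly on one side of every mirror ([chamber_side]).  Strictness needs an
interior point.  Local finiteness of the mirrors would provide one, but there
is a shorter way: the component defining the chamber has [k] in its closure but
not in itself, hence contains the whole arc from [k] to any of its points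
([chamber_interior]).  With the simple-root conditions at an interior point,
[alpha] has positive coordinates, so [alpha] is a positive multiple of
[1 + v ^ i] with [0 < i].  If [1 < i], the mirror of [1 + v] would separate [k]
from the other endpoint of the chamber.  Hence [i = 1], and primitivity of
[alpha] makes it the smallest positive multiple of [1 + v] in the ring of
integers ([positive_root_multiple]). *)

Set Implicit Arguments.
Unset Strict Implicit.
Unset Printing Implicit Defensive.

Import Order.TTheory GRing.Theory Num.Theory.
Import numFieldNormedType.Exports.
Local Open Scope classical_set_scope.
Local Open Scope ring_scope.
Local Open Scope quotient_scope.

(** * Norm and conjugation on quadratic algebras *)

Section Quad.
Variables (n : nat) (F : numFieldType).
Implicit Types x y : quad n F.

Lemma quad_ext x y : x.1 = y.1 -> x.2 = y.2 -> x = y.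
Proof. by case: x y => [a b] [c d] /= -> ->. Qed.

Lemma quadM1 x y : (x * y).1 = x.1 * y.1 + n%:R * (x.2 * y.2).
Proof. by []. Qed.

Lemma quadM2 x y : (x * y).2 = x.1 * y.2 + x.2 * y.1.
Proof. by []. Qed.

Lemma qnormE x : qnorm x = x.1 ^+ 2 - n%:R * x.2 ^+ 2.
Proof. by rewrite /qnorm quadM1 /=; ring. Qed.

Lemma qnormM x y : qnorm (x * y) = qnorm x * qnorm y.
Proof. by rewrite !qnormE quadM1 quadM2; ring. Qed.

Lemma qnorm1 : qnorm (1 : quad n F) = 1.
Proof. by rewrite qnormE /= expr0n mulr0 subr0 expr1n. Qed.

Lemma qnormX x m : qnorm (x ^+ m) = qnorm x ^+ m.
Proof. by elim: m => [|m IH]; rewrite ?qnorm1 // !exprS qnormM IH. Qed.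

Lemma mul_qconj x : x * qconj x = (qnorm x, 0).
Proof. by apply: quad_ext; rewrite // quadM2 /=; ring. Qed.

Lemma qconj_zmod_morphism : zmod_morphism (@qconj n F).
Proof. by move=> x y; apply: quad_ext => //=; ring. Qed.

Lemma qconj_monoid_morphism : monoid_morphism (@qconj n F).
Proof.
by split=> [|x y]; apply: quad_ext; rewrite ?quadM1 ?quadM2 /=; ring.
Qed.

HB.instance Definition _ :=
  GRing.isZmodMorphism.Build (quad n F) (quad n F) (@qconj n F)
    qconj_zmod_morphism.
HB.instance Definition _ :=
  GRing.isMonoidMorphism.Build (quad n F) (quad n F) (@qconj n F)
    qconj_monoid_morphism.

(** The copy of the base field inside [quad n F], as a ring morphism, so that
integrality of [(c, 0)] can be transported to [c]. *)
Definition quad_const (c : F) : quad n F := (c, 0).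

Lemma quad_const_zmod_morphism : zmod_morphism quad_const.
Proof. by move=> a b; apply: quad_ext => //=; ring. Qed.

Lemma quad_const_monoid_morphism : monoid_morphism quad_const.
Proof.
by split=> [|a b]; apply: quad_ext; rewrite ?quadM1 ?quadM2 /=; ring.
Qed.

HB.instance Definition _ :=
  GRing.isZmodMorphism.Build F (quad n F) quad_const quad_const_zmod_morphism.
HB.instance Definition _ :=
  GRing.isMonoidMorphism.Build F (quad n F) quad_const
    quad_const_monoid_morphism.

Lemma unit_qnorm x : qnorm x != 0 -> x \is a GRing.unit.
Proof. by []. Qed.

Lemma norm1_inv x : qnorm x = 1 -> x^-1 = qconj x.
Proof.
move=> Nx; have Ux : x \is a GRing.unit by rewrite unit_qnorm // Nx oner_eq0.
apply: (mulrI Ux); rewrite divrr // mul_qconj Nx.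
by [].
Qed.

End Quad.

(** * Algebraic integers and roots *)

Section Integers.
Variable n : nat.
Local Notation K := (quad n rat).
Implicit Types x y a u v w : K.

(** Restricted to [quad n rat], so that rewriting turns an integer multiple
into a rational one without touching the integer scalar [m%:~R] itself. *)
Lemma quad_mulrz x (m : int) : x *~ m = (m%:~R : rat) *: x.
Proof. by rewrite scaler_int. Qed.

Lemma ringO1 : ringO (1 : K).
Proof. exact: (integral1 (intmul 1 : {rmorphism int -> K})). Qed.

Lemma ringO_sub x y : ringO x -> ringO y -> ringO (x - y).
Proof.
by move=> ??; apply: (@integral_sub _ _ (intmul 1 : {rmorphism int -> K})).
Qed.

Lemma ringO_add x y : ringO x -> ringO y -> ringO (x + y).
Proof.
by move=> ??; apply: (@integral_add _ _ (intmul 1 : {rmorphism int -> K})).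
Qed.

Lemma ringO_mul x y : ringO x -> ringO y -> ringO (x * y).
Proof.
by move=> ??; apply: (@integral_mul _ _ (intmul 1 : {rmorphism int -> K})).
Qed.

Lemma ringO_mulrz x (m : int) : ringO x -> ringO (x *~ m).
Proof.
move=> Ox; rewrite -[x *~ m](@mulrzr K); apply: ringO_mul Ox _.
exact: (integral_id (intmul 1 : {rmorphism int -> K})).
Qed.

(** Conjugation fixes the integers, hence permutes the roots of each monic
integer polynomial. *)
Lemma ringO_conj x : ringO x -> ringO (qconj x).
Proof.
case=> p p_monic px0; exists p => //.
rewrite -(_ : map_poly (@qconj n rat) (map_poly (fun m : int => m%:~R) p)
  = map_poly (fun m : int => m%:~R) p).
  by rewrite rmorph_root.
rewrite -map_poly_comp; apply: eq_map_poly => m /=.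
by rewrite rmorph_int.
Qed.

(** A rational algebraic integer is an integer; the embedding of [rat] into
the algebraic numbers reduces this to the statement for [Aint]. *)
Lemma ringO_const (c : rat) :
  ringO (quad_const n c) -> exists m : int, c = m%:~R.
Proof.
case=> p p_monic; have -> : map_poly (fun m : int => (m%:~R : K)) p
    = map_poly (@quad_const n rat) (map_poly (intmul 1) p).
  by rewrite -map_poly_comp; apply: eq_map_poly => m /=; rewrite rmorph_int.
rewrite fmorph_root => pc0; apply/intrP; rewrite -Cint_rat.
apply: Cint_rat_Aint (Crat_rat c) _.
apply: (@root_monic_Aint (map_poly ratr (map_poly (intmul 1) p))).
- by rewrite fmorph_root.
- rewrite map_monic; apply: monic_map p_monic.
- apply/polyOverP => i; rewrite !coef_map /= ratr_int.
  exact: intr_int.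
Qed.

Lemma primitive_ratio a (c : rat) : primitive a -> a != 0 ->
  ringO (c *: a) -> exists j : int, c = j%:~R.
Proof.
move=> a_prim a0 Oca.
have [||j cE] := a_prim (c *: a) (denq c) Oca.
- exact: denq_neq0.
- exists (numq c); rewrite !quad_mulrz scalerA; congr (_ *: _).
  by rewrite numqE mulrC.
exists j; apply/eqP; rewrite -subr_eq0.
have : (c - j%:~R) *: a = 0 by rewrite scalerBl cE -quad_mulrz subrr.
by move/eqP; rewrite scaler_eq0 (negPf a0) orbF.
Qed.

(** If [c *: x] is integral, so is [c *: x * qconj x = (c * qnorm x, 0)], hence
[c * qnorm x] is an integer.  The rationals [c] with [c *: x] integral thus form
a discrete group, and the least positive one gives a primitive vector. *)
Lemma exists_primitive_multiple x : ringO x -> 0 < qnorm x ->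
  exists c : rat, [/\ 0 < c, ringO (c *: x) & primitive (c *: x)].
Proof.
move=> Ox Nx_gt0.
have qO c : ringO (c *: x) -> exists i : int, c * qnorm x = i%:~R.
  move=> Ocx; apply: ringO_const.
  rewrite (_ : quad_const n _ = (c *: x : K) * qconj x).
    exact: ringO_mul Ocx (ringO_conj Ox).
  by apply: quad_ext; rewrite ?quadM1 ?quadM2 ?qnormE /= /GRing.scale /=; ring.
have [|N NE] := qO 1; first by rewrite scale1r.
rewrite mul1r in NE.
have N_gt0 : (0 < N)%R by rewrite NE ltr0z in Nx_gt0.
pose P j := `[< (0 < j)%N /\ ringO ((j%:R / qnorm x) *: x) >].
have exP : exists j, P j.
  exists `|N|%N; apply/asboolP; split; first by rewrite absz_gt0 lt0r_neq0.
  have -> : `|N|%N%:R = qnorm x by rewrite NE pmulrn gez0_abs // ltW.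
  by rewrite divff ?scale1r ?lt0r_neq0.
case: (ex_minnP exP) => j /asboolP[j_gt0 Oj] j_min.
exists (j%:R / qnorm x); split=> //; first by rewrite divr_gt0 ?ltr0n.
move=> y m Oy m0 [i yE].
have yE' : y = (i%:~R * (j%:R / qnorm x) / m%:~R) *: x.
  apply: (@scalerI _ _ (m%:~R : rat)); first by rewrite intr_eq0.
  rewrite -quad_mulrz yE quad_mulrz !scalerA; congr (_ *: _).
  by field; rewrite intr_eq0 m0 lt0r_neq0.
have [|k kE] := qO (i%:~R * (j%:R / qnorm x) / m%:~R); first by rewrite -yE'.
set c := _ / m%:~R in yE' kE.
have cE : c = k%:~R / qnorm x by rewrite -kE mulfK // lt0r_neq0.
exists (k %/ j%:Z)%Z.
have [r rE] : exists r : nat, (k %% j%:Z)%Z = r.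
  by exists `|(k %% j%:Z)%Z|%N; rewrite gez0_abs // modz_ge0 // lt0r_neq0.
have kDE : k%:~R = (k %/ j%:Z)%Z%:~R * j%:R + r%:R :> rat.
  by rewrite [in LHS](divz_eq k j%:Z) rE rmorphD rmorphM.
have r_lt : (r < j)%N.
  by rewrite -ltz_nat -rE ltz_pmod.
have Or : ringO ((r%:R / qnorm x) *: x).
  rewrite (_ : _ *: x = y - ((j%:R / qnorm x) *: x) *~ (k %/ j%:Z)%Z).
    exact: ringO_sub Oy (ringO_mulrz _ Oj).
  rewrite yE' cE quad_mulrz scalerA -scalerBl; congr (_ *: _).
  rewrite kDE; ring.
have r0 : r = 0%N.
  apply/eqP; rewrite -leqn0 leqNgt; apply/negP => r_gt0.
  have /j_min : P r by apply/asboolP.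
  by rewrite leqNgt r_lt.
rewrite yE' cE quad_mulrz scalerA; congr (_ *: _).
by rewrite kDE r0 addr0 mulrA.
Qed.

(** Here [w] is [a / qconj a]: evaluating the reflection at 1 gives
[- w = 1 - m a] with [m] an integer, which puts [w] in the ring of integers. *)
Lemma root_unit a : lattice_root a -> 0 < a.1 -> exists w d,
  [/\ ringO w, qnorm w = 1, 0 < w.1, 0 < d & 1 + w = d *: a].
Proof.
case=> Oa _ Na_gt0 /(_ 1 ringO1)[m mE] a1_gt0.
have N0 := lt0r_neq0 Na_gt0.
have mE' : m%:~R = 2 * a.1 / dot a a.
  have <- : dot a 1 = a.1 by rewrite dotE /=; ring.
  by rewrite mE; field.
have NaE : dot a a = a.1 ^+ 2 - n%:R * a.2 ^+ 2 by rewrite dot_qnorm qnormE.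
exists (a *~ m - 1), (2 * a.1 / dot a a).
have wE : a *~ m - 1 = ((a.1 ^+ 2 + n%:R * a.2 ^+ 2) / dot a a,
                        2 * a.1 * a.2 / dot a a) :> K.
  rewrite quad_mulrz mE'; apply: quad_ext => /=;
    by rewrite /GRing.scale /=; field: NaE.
split.
- exact: ringO_sub (ringO_mulrz m Oa) ringO1.
- by rewrite wE qnormE /= NaE; field; rewrite -NaE.
- rewrite wE /= divr_gt0 //.
  have n_ge0 : 0 <= n%:R * a.2 ^+ 2 by rewrite mulr_ge0 ?sqr_ge0.
  by move: Na_gt0; rewrite NaE; lra.
- by rewrite divr_gt0 // mulr_gt0.
- by rewrite addrC subrK quad_mulrz mE'.
Qed.

Lemma norm1_pow w m : qnorm w = 1 -> 0 < w.1 -> 0 < w.2 ->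
  1 <= (w ^+ m).1 /\ 0 <= (w ^+ m).2.
Proof.
move=> Nw w1_gt0 w2_gt0; elim: m => [|m [IH1 IH2]]; first by rewrite expr0.
have w1_ge1 : 1 <= w.1.
  have n_ge0 : 0 <= n%:R * w.2 ^+ 2 by rewrite mulr_ge0 ?sqr_ge0.
  by move: Nw; rewrite qnormE; nra.
rewrite exprS quadM1 quadM2; split.
  have : 0 <= n%:R * (w.2 * (w ^+ m).2) by rewrite !mulr_ge0 // ltW.
  nra.
by rewrite addr_ge0 ?mulr_ge0 // ltW // (lt_le_trans ltr01).
Qed.

Lemma norm1_pow_gt0 w m : qnorm w = 1 -> 0 < w.1 -> 0 < w.2 -> (0 < m)%N ->
  0 < (w ^+ m).2.
Proof.
case: m => // m Nw w1_gt0 w2_gt0 _.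
have [wm1 wm2] := norm1_pow m Nw w1_gt0 w2_gt0.
rewrite exprS quadM2 ltr_wpDl ?mulr_ge0 ?mulr_gt0 // ?ltW //.
exact: lt_le_trans wm1.
Qed.

(** Negative powers of [v] are conjugates of positive ones, so they have
second coordinate at most 0. *)
Lemma positive_power v w (i : int) : qnorm v = 1 -> 0 < v.1 -> 0 < v.2 ->
  0 < w.1 -> 0 < w.2 -> (w = v ^ i \/ w = - v ^ i) ->
  exists m, w = v ^+ m.+1.
Proof.
move=> Nv v1_gt0 v2_gt0 w1_gt0 w2_gt0.
have ge m := norm1_pow m Nv v1_gt0 v2_gt0.
case: i => [[|m]|m] w_v.
- by case: w_v w2_gt0 => ->; rewrite ?oppr0 ltxx.
- case: w_v => wE; first by exists m.
  have [vm1 _] := ge m.+1; rewrite wE /= in w1_gt0.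
  by move: w1_gt0; rewrite oppr_gt0 ltNge (le_trans ler01).
- have vE : v ^ (Negz m) = qconj (v ^+ m.+1).
    by rewrite NegzE -exprnN norm1_inv // qnormX Nv expr1n.
  have [vm1 vm2] := ge m.+1; case: w_v => wE; rewrite wE vE /= in w1_gt0 w2_gt0.
    by move: w2_gt0; rewrite oppr_gt0 ltNge vm2.
  by move: w1_gt0; rewrite oppr_gt0 ltNge (le_trans ler01).
Qed.

Lemma unit_norm_one w : ringO w -> qnorm w = 1 -> unitO w.
Proof.
move=> Ow Nw; split; first exact: Ow.
exists (qconj w); first exact: ringO_conj Ow.
by rewrite mul_qconj Nw.
Qed.

(** When [u] has norm -1, a power [u ^ i] of norm 1 has even exponent, so it is
a power of [v = u ^+ 2]. *)
Lemma fundamental_power u v w : fundamental_unit u ->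
  (qnorm u = 1 /\ v = u) \/ (qnorm u = - 1 /\ v = u ^+ 2) ->
  qnorm v = 1 /\ (ringO w -> qnorm w = 1 ->
    exists i : int, w = v ^ i \/ w = - v ^ i).
Proof.
move=> [[Ou _] u_gen] [[Nu ->]|[Nu ->]].
  by split=> // Ow Nw; apply/u_gen/unit_norm_one.
split; first by rewrite qnormX Nu sqrrN expr1n.
move=> Ow Nw; have [i w_u] := u_gen _ (unit_norm_one Ow Nw).
have Uu : u \is a GRing.unit by rewrite unit_qnorm // Nu oppr_eq0 oner_eq0.
have qnormV x : qnorm x != 0 -> qnorm x^-1 = (qnorm x)^-1.
  move=> x0; apply: (mulfI x0); rewrite divff // -qnormM divrr ?qnorm1 //.
have qnormN x : qnorm (- x) = qnorm x by rewrite !qnormE /= !sqrrN.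
have Nui : qnorm (u ^ i) = (-1) ^ i.
  case: i {w_u} => m; first by rewrite -exprnP qnormX Nu.
  rewrite NegzE -!exprnN qnormV qnormX Nu //.
  by rewrite expf_neq0 // oppr_eq0 oner_eq0.
have i_sign : (-1 : rat) ^ i = 1.
  by rewrite -Nui -Nw; case: w_u => ->; rewrite ?qnormN.
have [j iE] : exists j : int, i = 2 * j.
  exists (i %/ 2)%Z.
  have [//|i_odd] : i = 2 * (i %/ 2)%Z \/ i = 2 * (i %/ 2)%Z + 1 by lia.
  move: i_sign; rewrite i_odd exprzDr ?unitrN1 // -exprz_exp.
  rewrite (_ : (-1 : rat) ^ 2 = 1) // exp1rz mul1r expr1z.
  by move=> /eqP; rewrite -subr_eq0.
by exists j; rewrite exprnP exprz_exp -iE.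
Qed.

(** Because [v = (1 + v) / qconj (1 + v)], the reflection in [1 + v] is
[x |-> - v * qconj x], which preserves the ring of integers. *)
Lemma root_of_norm_one v (c : rat) : ringO v -> qnorm v = 1 -> 0 < v.1 ->
  0 < c -> ringO (c *: (1 + v)) -> primitive (c *: (1 + v)) ->
  lattice_root (c *: (1 + v)).
Proof.
move=> Ov Nv v1_gt0 c_gt0 Ocv cv_prim.
have v1_neq0 : 1 + v.1 != 0 by rewrite lt0r_neq0 // addr_gt0.
have c_neq0 := lt0r_neq0 c_gt0.
have NvE : n%:R * v.2 ^+ 2 = v.1 ^+ 2 - 1 by move: Nv; rewrite qnormE; lra.
have cvE : dot (c *: (1 + v)) (c *: (1 + v)) = 2 * c ^+ 2 * (1 + v.1).
  transitivity (c ^+ 2 * ((1 + v.1) ^+ 2 - n%:R * v.2 ^+ 2)).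
    by rewrite dotE /= /GRing.scale /=; ring.
  by rewrite NvE; ring.
split.
- exact: Ocv.
- exact: cv_prim.
- by rewrite cvE !mulr_gt0 ?exprn_gt0 ?addr_gt0.
move=> x Ox.
pose q := 2 * dot (c *: (1 + v)) x / dot (c *: (1 + v)) (c *: (1 + v)).
have cv0 : c *: (1 + v) != 0.
  apply: contraNneq v1_neq0 => /(congr1 fst) /= /eqP.
  by rewrite /GRing.scale /= mulf_eq0 (negPf c_neq0).
have Oq : ringO (q *: (c *: (1 + v))).
  have -> : q *: (c *: (1 + v)) = x + v * qconj x.
    rewrite /q cvE; set d := dot _ x.
    have dE : d = c * ((1 + v.1) * x.1 - n%:R * v.2 * x.2).
      by rewrite /d dotE /= /GRing.scale /=; ring.
    have dv2 : d * v.2 = c * (1 + v.1) * (v.2 * x.1 + (1 - v.1) * x.2).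
      transitivity (c * ((1 + v.1) * x.1 * v.2 - n%:R * v.2 ^+ 2 * x.2)).
        by rewrite dE; ring.
      by rewrite NvE; ring.
    apply: quad_ext; rewrite ?quadM1 ?quadM2 /= /GRing.scale /=.
      by rewrite dE; field; rewrite v1_neq0 c_neq0.
    transitivity (d * v.2 / (c * (1 + v.1))); last rewrite dv2;
      by field; rewrite v1_neq0 c_neq0.
  exact: ringO_add Ox (ringO_mul Ov (ringO_conj Ox)).
have [m qE] := primitive_ratio cv_prim cv0 Oq.
exists m; rewrite -qE /q; field.
by rewrite cvE !mulf_neq0 ?expf_neq0.
Qed.

End Integers.

(** * Sides of mirrors on the projective line *)

Section Projective.
Variables (n : nat) (R : realType).
Hypothesis n_gt0 : (0 < n)%N.
Local Notation V := (quad n R).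
Local Notation projV := (projV n R).
Implicit Types (x y a b : V) (P C : set projV) (q : projV).

Let nR_gt0 : (0 : R) < n%:R. Proof. by rewrite ltr0n. Qed.

(** Homogeneous conditions on vectors are the ones that can be tested on any
representative of a projective point. *)
Definition homogeneous (X : set V) := forall c x, c != 0 -> X x -> X (c *: x).

Lemma projE (X : set V) (x : @nonzero n R) : homogeneous X ->
  Defs.proj X (\pi_projV x) = X (\val x).
Proof.
move=> hX; apply/propext; split; last by exists x.
case=> y Xy /eqmodP /asboolP [c c0 ->]; exact: hX.
Qed.

Lemma open_proj (X : set V) : homogeneous X -> open X -> open (Defs.proj X).
Proof.
move=> hX oX; rewrite /open /= /quotient_open.
rewrite (_ : _ @^-1` _ = (set_val : @nonzero n R -> V) @^-1` X).
  by apply: open_comp => // x _; exact: initial_continuous.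
by apply/seteqP; split=> x /=; rewrite projE.
Qed.

(** The product of two linear forms is homogeneous of even degree, so its sign
descends to the projective line: [between a b] is one of the two open arcs cut
out by the mirrors of [a] and [b]. *)
Definition between a b : set V := [set x | dot x a * dot x b < 0].

Lemma dotZl c x b : dot (c *: x) b = c * dot x b.
Proof. by rewrite !dotE /= /GRing.scale /=; ring. Qed.

Lemma between_homogeneous a b : homogeneous (between a b).
Proof.
move=> c x c0; rewrite /between /= !dotZl.
move: (dot x a) (dot x b) => r s rs_lt0.
by rewrite mulrACA -expr2 pmulr_rlt0 // exprn_even_gt0.
Qed.

Lemma continuous_dot b : continuous (fun x : V => dot x b).
Proof.
have -> : (fun x => dot x b) = fun x : V => x.1 * b.1 - n%:R * (x.2 * b.2).
  by apply/funext => x; rewrite dotE.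
move=> x.
have x1 : fst z @[z --> x] --> x.1 by exact: cvg_fst.
have x2 : snd z @[z --> x] --> x.2 by exact: cvg_snd.
exact: cvgB (cvgM x1 (cvg_cst _)) (cvgM (cvg_cst _) (cvgM x2 (cvg_cst _))).
Qed.

Lemma open_between a b : open (between a b).
Proof.
rewrite (_ : between a b =
  (fun x => dot x a * dot x b) @^-1` [set r | r < 0]) //.
apply: open_comp; last exact: open_lt.
by move=> x _; apply: cvgM; exact: continuous_dot.
Qed.

(** The mirror of [qsqrt] is the point at infinity [x.2 = 0], so [side b] is the
open half of the affine line where a representative with [0 < x.2] has
positive inner product with [b]. *)
Definition side b : set projV := Defs.proj (between qsqrt b).

Lemma affine_neq0 (t : R) : @nonzero n R (t, 1).
Proof. by apply/eqP => -[_] /eqP; rewrite oner_eq0. Qed.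

Definition affine (t : R) : @nonzero n R := SigSub (mem_set (affine_neq0 t)).

Definition pt (t : R) : projV := \pi_projV (affine t).

Lemma pi_pt (x : @nonzero n R) : (\val x).2 != 0 ->
  \pi_projV x = pt ((\val x).1 / (\val x).2).
Proof.
move=> x2_neq0; apply/eqmodP/asboolP; exists (\val x).2^-1.
  by rewrite invr_eq0.
by apply: quad_ext; rewrite /= /GRing.scale /= ?mulVf // mulrC.
Qed.

Lemma dot_pt t b : dot ((t, 1) : V) b = t * b.1 - n%:R * b.2.
Proof. by rewrite dotE /= mul1r. Qed.

Lemma side_pt b t : side b (pt t) = (0 < t * b.1 - n%:R * b.2) :> Prop.
Proof.
rewrite -dot_pt /side /pt projE; last exact: between_homogeneous.
rewrite /between /=.
have -> : dot ((t, 1) : V) qsqrt = - n%:R by rewrite dot_pt /=; ring.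
move: (dot _ b) => r.
by rewrite mulNr oppr_lt0 pmulr_rgt0.
Qed.

Lemma mirror_pt b t : mirror b (pt t) = (t * b.1 - n%:R * b.2 = 0) :> Prop.
Proof.
rewrite -dot_pt /mirror /pt projE // => c x _ /=.
by rewrite dotZl => ->; rewrite mulr0.
Qed.

Lemma qnorm_homogeneous : homogeneous [set x : V | dot x x < 0].
Proof.
move=> c x c0 /=; rewrite !dotE /= /GRing.scale /= => lt0.
rewrite [ltLHS](_ : _ = c ^+ 2 * (x.1 * x.1 - n%:R * (x.2 * x.2))); last first.
  by ring.
by rewrite pmulr_rlt0 // exprn_even_gt0.
Qed.

Lemma H1_pt t : @H1 n R (pt t) = (t ^+ 2 < n%:R) :> Prop.
Proof.
rewrite /H1 /pt projE; last exact: qnorm_homogeneous.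
by rewrite /= dot_pt /= mulr1 subr_lt0 -expr2.
Qed.

Lemma pi_H1 (x : @nonzero n R) : @H1 n R (\pi_projV x) -> (\val x).2 != 0.
Proof.
rewrite /H1 projE; last exact: qnorm_homogeneous.
rewrite /= dotE; apply: contraTneq => ->.
by rewrite !mulr0 subr0 -leNgt -expr2 sqr_ge0.
Qed.

Lemma H1_ptP q : @H1 n R q -> exists t, q = pt t.
Proof.
elim/quotP: q => x _ /pi_H1 x2; rewrite pi_pt //.
by exists ((\val x).1 / (\val x).2).
Qed.

Lemma open_side b : open (side b).
Proof.
by apply: open_proj; [exact: between_homogeneous | exact: open_between].
Qed.

Lemma dotNr x b : dot x (- b) = - dot x b.
Proof. by rewrite !dotE /=; ring. Qed.

Lemma side_disjoint b q : side b q -> ~ side (- b) q.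
Proof.
elim/quotP: q => x _; rewrite /side !projE; try exact: between_homogeneous.
rewrite /between /= dotNr mulrN oppr_lt0 => lt0.
by move/(lt_trans lt0); rewrite ltxx.
Qed.

(** The opposite side is open and disjoint from [P]. *)
Lemma closure_side P b : P `<=` side b ->
  forall q, closure P q -> ~ side (- b) q.
Proof.
move=> P_b q /(_ (side (- b))) P_q q_b.
have [|r [/P_b]] := P_q; last exact: side_disjoint.
by apply: open_nbhs_nbhs; split=> //; exact: open_side.
Qed.

(** The two sides are disjoint open sets that cover [H1] outside the mirror. *)
Lemma connected_side P b : connected P -> P `<=` @H1 n R ->
  (forall q, P q -> ~ mirror b q) -> P `<=` side b \/ P `<=` side (- b).
Proof.
move=> P_conn P_H1 P_b; apply: (connected_subset _ _ P_conn).
  split; apply/seteqP; split=> // q [].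
    exact: (closure_side (fun _ => id)).
  move=> q_b /(@closure_side (side (- b)) (- b) (fun _ => id)).
  by rewrite opprK.
move=> q Pq; have [t qt] := H1_ptP (P_H1 q Pq); have := P_b q Pq.
rewrite qt mirror_pt /setU /= !side_pt /= !mulrN -opprD oppr_gt0 => d_neq0.
by case: (ltgtP (t * b.1 - n%:R * b.2) 0) d_neq0 => // _ _; [right|left].
Qed.

Lemma chamber_side C b : chamber C -> dot b b != 0 -> weyl (reflection b) ->
  (forall q, C q -> ~ side b q) \/ (forall q, C q -> ~ side (- b) q).
Proof.
move=> [p _ ->] b0 wb; set P := connected_component _ _.
have P_sub : P `<=` @H1 n R `\` @mirrors n R by exact: connected_component_sub.
have [||q /P_sub [_ q_m] q_b|P_b|P_b] := @connected_side P b.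
- exact: component_connected.
- by move=> q /P_sub [].
- by apply: q_m; exists b.
- by right=> q [/(closure_side P_b)].
- by left=> q [/(closure_side P_b)]; rewrite opprK.
Qed.

(** The segment from [qsqrt] to [(t, 1)] stays in the negative cone. *)
Lemma future_pt t : t ^+ 2 < n%:R -> future ((t, 1) : V).
Proof.
move=> t_lt; pose f (s : R) : V := (s * t, 1).
apply: (@connected_component_max _ _ (f @` `[0, 1])).
- by exists 0; rewrite /f /= ?mul0r // in_itv /= lexx ler01.
- move=> _ [s /=] /[!in_itv] /= /andP[s_ge0 s_le1] <-.
  rewrite dot_pt /= mulr1 subr_lt0 -expr2 exprMn.
  apply: le_lt_trans t_lt; rewrite ler_piMl ?sqr_ge0 //.
  by rewrite expr_le1.
- apply: connected_continuous_connected; first exact: segment_connected.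
  apply: continuous_subspaceT => s.
  have st : r * t @[r --> s] --> s * t by exact: cvgM cvg_id (cvg_cst _).
  exact: (cvg_pair st (cvg_cst (1 : R))).
- by exists 1; rewrite /f /= ?mul1r // in_itv /= lexx ler01.
Qed.

Lemma representatives_pt (S : set projV) t :
  S (pt t) -> representatives S ((t, 1) : V).
Proof. by move=> St; exists (affine t). Qed.

Lemma representatives_qsqrt (S : set projV) :
  representatives S (qsqrt : V) -> S (pt 0).
Proof.
move=> [x Sx x_k]; rewrite /= in Sx; move: Sx; rewrite pi_pt x_k ?oner_eq0 //=.
by rewrite mul0r.
Qed.

(** Every [pt s] strictly between [pt 0] and a point [pt t] of the component [P]
belongs to [P]: otherwise the mirror through [pt s] misses [P], hence separates
[pt t] from [pt 0], which is in the closure of [P].  These [pt s] form a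
nonempty open set, described by [s * (s - t) < 0]. *)
Lemma chamber_interior C b : chamber C -> C (pt 0) ->
  mirror b (pt 0) -> b.1 != 0 -> weyl (reflection b) ->
  exists2 t, t ^+ 2 < n%:R & (interior C) (pt t).
Proof.
move=> [p [p_H1 p_m] ->] C0 b_0 b0 wb.
have b2 : b.2 = 0.
  move: b_0; rewrite mirror_pt mul0r sub0r => /eqP.
  by rewrite oppr_eq0 mulf_eq0 (gt_eqF nR_gt0) => /eqP.
have [t pE] := H1_ptP p_H1.
have t_neq0 : t != 0.
  apply/eqP => t0; apply: p_m; exists b; last by rewrite pE t0.
  by split=> //; rewrite dotE b2 !mulr0 subr0 mulf_neq0.
have t_n : t ^+ 2 < n%:R by move: p_H1; rewrite pE H1_pt.
move: C0; set P := connected_component _ _ => -[P_0 _].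
have P_sub : P `<=` @H1 n R `\` @mirrors n R by exact: connected_component_sub.
have P_p : P p by exact: connected_component_refl.
pose U : set projV := Defs.proj (between 1 ((1, t / n%:R) : V)).
have U_pt s : U (pt s) = (s * (s - t) < 0) :> Prop.
  rewrite /U /pt projE; last exact: between_homogeneous.
  rewrite /between /= !dot_pt /=.
  by congr (is_true (_ < _)); field; rewrite gt_eqF.
have U_open : open U.
  by apply: open_proj; [exact: between_homogeneous | exact: open_between].
have U_P : U `<=` P.
  move=> q; elim/quotP: q => x _ Ux.
  have x2 : (\val x).2 != 0.
    move: Ux; rewrite /U projE; last exact: between_homogeneous.
    rewrite /between /= !dotE /=; apply: contraTneq => ->.
    by rewrite -leNgt !mul0r !mulr0 !subr0 !mulr1 -expr2 sqr_ge0.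
  move: Ux; rewrite pi_pt //; move: (_ / _) => s; rewrite U_pt => st_lt0.
  have s_n : s ^+ 2 < n%:R by nra.
  apply: contrapT => nPs.
  (* [c] is chosen orthogonal to [(s, 1)] *)
  pose c : V := (1, s / n%:R).
  have side_c z : side c (pt z) = (s < z) :> Prop.
    by rewrite side_pt /= mulr1 mulrC divfK ?gt_eqF // subr_gt0.
  have side_Nc z : side (- c) (pt z) = (z < s) :> Prop.
    rewrite side_pt /= !mulrN mulr1 opprK [n%:R * _]mulrC.
    by rewrite divfK ?gt_eqF // addrC subr_gt0.
  have [||q Pq q_c|P_c|P_c] := @connected_side P c.
  - exact: component_connected.
  - by move=> q /P_sub [].
  - apply: nPs; have [z zE] := H1_ptP (P_sub _ Pq).1.
    move: q_c; rewrite zE mirror_pt /= mulr1 mulrC divfK ?gt_eqF //.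
    by move=> /subr0_eq <-; rewrite -zE.
  - have : ~ side (- c) (pt 0) := closure_side P_c P_0.
    have := P_c _ P_p; rewrite pE side_c side_Nc; nra.
  - have : ~ side (- - c) (pt 0) := closure_side P_c P_0.
    have := P_c _ P_p; rewrite pE opprK side_c side_Nc; nra.
exists (t / 2); first by nra.
apply: (@filterS _ _ _ U); last first.
  by apply: open_nbhs_nbhs; split=> //; rewrite U_pt; nra.
move=> q Uq; split; first exact/subset_closure/U_P.
by left; exact: (P_sub _ (U_P _ Uq)).1.
Qed.

End Projective.

(** * Mirrors of lattice vectors *)

Section Rational.
Variables (n : nat) (R : realType).
Hypothesis n_gt0 : (0 < n)%N.
Local Notation K := (quad n rat).

Lemma side_toV (b : K) (s : rat) :
  side (toV R b) (@pt n R (ratr s)) = (0 < s * b.1 - n%:R * b.2) :> Prop.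
Proof. by rewrite side_pt // -(ltr0q R) rmorphB !rmorphM /= ratr_nat. Qed.

Lemma side_NtoV (b : K) (s : rat) :
  side (- toV R b) (@pt n R (ratr s)) = (s * b.1 - n%:R * b.2 < 0) :> Prop.
Proof.
rewrite side_pt // -(ltrq0 R) rmorphB !rmorphM /= ratr_nat.
by rewrite !mulrN -opprD oppr_gt0.
Qed.

Lemma mirror_toV (b : K) q : b.1 != 0 -> mirror (toV R b) q ->
  q = pt n (ratr (n%:R * b.2 / b.1)).
Proof.
move=> b1; elim/quotP: q => x _; rewrite /mirror projE; last first.
  by move=> c y _ /=; rewrite dotZl => ->; rewrite mulr0.
have b1R : ratr b.1 != 0 :> R by rewrite fmorph_eq0.
rewrite /= dotE /= => /eqP; rewrite subr_eq0 => /eqP xb.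
have x2 : (\val x).2 != 0.
  apply/eqP => x2; have /eqP := set_mem (valP x); apply.
  apply: quad_ext => //; apply/eqP; move/eqP: xb.
  by rewrite x2 mul0r mulr0 mulf_eq0 (negPf b1R) orbF.
rewrite pi_pt //; congr (pt _ _); apply/eqP.
by rewrite fmorph_div rmorphM /= ratr_nat eqr_div // xb; apply/eqP; ring.
Qed.

End Rational.

(** All integral multiples of a primitive vector are integer multiples, and a
positive integer is at least 1. *)
Lemma positive_root_multiple (n : nat) (a w : quad n rat) (c : rat) :
  lattice_root a -> 0 < c -> a = c *: w -> smallest_positive_multiple w a.
Proof.
move=> [Oa a_prim Na _] c_gt0 aE; exists c; split=> // c' c'_gt0 Oc'.
have a0 : a != 0.
  by apply: contraTneq Na => ->; rewrite dotE !mul0r !mulr0 subrr.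
have wE : c' *: w = (c' / c) *: a by rewrite aE scalerA divfK // lt0r_neq0.
rewrite wE in Oc'; have [j jE] := primitive_ratio a_prim a0 Oc'.
have : 0 < c' / c by rewrite divr_gt0.
rewrite jE ltr0z => j_gt0.
have : 1 <= c' / c by rewrite jE ler1z; lia.
by rewrite ler_pdivlMr // mul1r.
Qed.

Lemma rational_root_pm1 n (a : quad n rat) : lattice_root a -> a.2 = 0 ->
  a = 1 \/ a = -1.
Proof.
move=> [Oa a_prim Na _] a2.
have aE : a = quad_const n a.1 by apply: quad_ext.
have [m mE] : exists m : int, a.1 = m%:~R.
  by apply: (@ringO_const n); rewrite -aE.
have a1 : a.1 != 0.
  by apply: contraTneq Na => a1; rewrite dotE a1 a2 !mul0r !mulr0 subrr.
have a0 : a != 0 by apply: contraNneq a1 => ->.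
have [|j jE] := @primitive_ratio n a a.1^-1 a_prim a0.
  rewrite (_ : _ *: a = (1 : quad n rat)); first exact: ringO1.
  by apply: quad_ext; rewrite /= /GRing.scale /= ?mulVf // a2 mulr0.
have jm : j * m = 1.
  by apply: (@intr_inj rat); rewrite intrM -jE -mE mulVf.
have [m1|m1] : m = 1 \/ m = -1.
  have /eqP : (`|j| * `|m|)%N = 1%N by rewrite -abszM jm.
  by rewrite muln_eq1 => /andP[_ /eqP]; lia.
  by left; rewrite aE mE m1.
by right; rewrite aE mE m1; apply: quad_ext; rewrite //= oppr0.
Qed.

(** The mirror of [b] is at [t = n * b.2 / b.1]; cleared of denominators, this
compares the mirrors of [1 + v] and [1 + v * w].  The difference of the two
sides is [v.1 * w.2 + v.2 * (w.1 - 1) + w.2 * qnorm v], a sum of positive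
terms since [w] has norm 1 and so [1 < w.1]. *)
Lemma mirror_order n (v w : quad n rat) : qnorm v = 1 -> 0 < v.1 -> 0 < v.2 ->
  0 < n%:R :> rat -> qnorm w = 1 -> 0 < w.1 -> 0 < w.2 ->
  (1 + (v * w).1) * v.2 < (v * w).2 * (1 + v.1).
Proof.
rewrite !qnormE quadM1 quadM2 => Nv v1 v2 n0 Nw w1 w2.
have nw : 0 < n%:R * w.2 ^+ 2 by rewrite mulr_gt0 // exprn_gt0.
have w1_gt1 : 1 < w.1 by nra.
rewrite -subr_gt0.
rewrite [ltRHS](_ : _ = v.1 * w.2 + v.2 * (w.1 - 1)
  + w.2 * (v.1 ^+ 2 - n%:R * v.2 ^+ 2)); last by ring.
by rewrite Nv mulr1 !addr_gt0 ?mulr_gt0 ?subr_gt0.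
Qed.

(** * The simple roots of the chamber *)

Theorem theorem4p1 (R : realType) (n : nat) (C : set (projV n R))
    (alpha u v : quad n rat) :
  (1 < n)%N -> squarefree n ->
  chamber C -> representatives C qsqrt -> simple_root C (- 1) ->
  simple_root C alpha -> alpha <> - 1 ->
  fundamental_unit u ->
  (qnorm u = 1 /\ v = u) \/ (qnorm u = - 1 /\ v = u ^+ 2) ->
  0 < qtrace v -> dot v qsqrt < 0 ->
  smallest_positive_multiple (1 + v) alpha.
Proof.
move=> n_gt1 _ chC /representatives_qsqrt C0.
have n_gt0 : (0 < n)%N by apply: ltnW.
have nQ_gt0 : (0 : rat) < n%:R by rewrite ltr0n.
have {}C0 : C (@pt n R (ratr 0)) by rewrite rmorph0.
case=> root1 _ neg1 [root_a [qa [Ca _] qa_mirror] neg_a] a_neq.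
move=> u_fund uv v_tr v_dot.
have v1_gt0 : 0 < v.1 by move: v_tr; rewrite /qtrace /=; lra.
have v2_gt0 : 0 < v.2.
  by move: v_dot; rewrite dotE /= mulr0 sub0r mulr1 oppr_lt0 pmulr_rgt0.
have root_mirror (b : quad n rat) : lattice_root b ->
    dot (toV R b) (toV R b) != 0 /\ weyl (reflection (toV R b)).
  move=> root_b; split; last exact: weyl_refl.
  have [_ _ Nb _] := root_b; apply: contraTneq Nb => Nb0.
  rewrite -leNgt -(lerq0 R) -Nb0 !dotE /=.
  by rewrite rmorphB !rmorphM /= ratr_nat.
have one1 : (- 1 : quad n rat).1 != 0 by rewrite oppr_eq0 oner_eq0.
have a1_neq0 : alpha.1 != 0.
  have [_ _ Na _] := root_a; apply: contraTneq Na => a1.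
  by rewrite -leNgt dotE a1 mul0r sub0r oppr_le0 mulr_ge0 // -expr2 sqr_ge0.
have [D1 W1] := root_mirror _ root1.
have [Da Wa] := root_mirror _ root_a.
have [t t_n Ct] : exists2 t : R, t ^+ 2 < n%:R & (interior C) (@pt n R t).
  apply: (@chamber_interior n R n_gt0 C (toV R (- 1))) => //.
  - by rewrite -(rmorph0 (@ratr R)).
  - by rewrite mirror_pt // /= mul0r oppr0 rmorph0 mulr0 subr0.
  - by rewrite /= fmorph_eq0.
have t_future := future_pt t_n.
have t_rep := representatives_pt Ct.
(* at [pt t] the simple-root inequalities are strict, which decides on which
   side of each mirror the chamber lies *)
have t_neg (b : quad n rat) : dot (toV R b) ((t, 1) : quad n R) < 0 ->
    side (- toV R b) (@pt n R t).
  by rewrite side_pt // dotE /= mulr1 !mulrN -opprD oppr_gt0 mulrC.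
have t_1 := t_neg _ (neg1 _ t_future t_rep).
have t_a := t_neg _ (neg_a _ t_future t_rep).
have C_t : C (@pt n R t) := interior_subset Ct.
have C_1 q : C q -> ~ side (toV R (- 1)) q.
  by have [|/(_ _ C_t)] := chamber_side n_gt0 chC D1 W1; first exact.
have C_a q : C q -> ~ side (toV R alpha) q.
  by have [|/(_ _ C_t)] := chamber_side n_gt0 chC Da Wa; first exact.
rewrite (mirror_toV a1_neq0 qa_mirror) in Ca.
have a2_ge0 : 0 <= alpha.2.
  have := C_a _ C0; rewrite side_toV // mul0r sub0r oppr_gt0 pmulr_rlt0 //.
  by move=> /negP; rewrite -leNgt.
have a2_gt0 : 0 < alpha.2.
  rewrite lt_neqAle a2_ge0 andbT eq_sym; apply/eqP => a2.
  have [a1|//] := rational_root_pm1 root_a a2.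
  apply: (side_disjoint t_1); move: t_a; rewrite a1.
  congr (side _ _).
  by apply: quad_ext; rewrite /= ?rmorphN ?opprK ?oppr0 ?rmorph0 ?oppr0.
have a1_gt0 : 0 < alpha.1.
  rewrite lt_neqAle eq_sym a1_neq0 /= leNgt; apply/negP => a1_lt0.
  have := C_1 _ Ca; rewrite side_toV //=; apply.
  by rewrite oppr0 mulr0 subr0 mulrN1 oppr_gt0 pmulr_rlt0 ?invr_lt0 // mulr_gt0.
have [w [d [Ow Nw w1_gt0 d_gt0 wE]]] := root_unit root_a a1_gt0.
have w1 : 1 + w.1 = d * alpha.1 by have := congr1 fst wE.
have w2 : w.2 = d * alpha.2 by have := congr1 snd wE; rewrite /= add0r.
have w2_gt0 : 0 < w.2 by rewrite w2 mulr_gt0.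
have [Nv w_pow] := fundamental_power w u_fund uv.
have [i w_i] := w_pow Ow Nw.
have [m wm] := positive_power Nv v1_gt0 v2_gt0 w1_gt0 w2_gt0 w_i.
(* [m = 0] is the case [w = v]; otherwise the mirror of [1 + v] separates the
   mirror points of [-1] and [alpha], both of which lie in the chamber *)
have [m0|m_gt0] := posnP m.
  apply: (positive_root_multiple (c := d^-1)) => //; first by rewrite invr_gt0.
  rewrite -(expr1 v) -[1%N]/(0.+1) -m0 -wm wE scalerA mulVf ?scale1r //.
  exact: lt0r_neq0.
exfalso.
have Ov : ringO v.
  have [[Ou _] _] := u_fund.
  case: uv => -[_ ->]; [exact: Ou | rewrite expr2; exact: (ringO_mul Ou Ou)].
have O1v := ringO_add (ringO1 n) Ov.
have [|c [c_gt0 Oc c_prim]] := exists_primitive_multiple O1v.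
  by move: Nv; rewrite !qnormE /=; lra.
have [Db Wb] := root_mirror _ (root_of_norm_one Ov Nv v1_gt0 c_gt0 Oc c_prim).
have [C_b|C_b] := chamber_side n_gt0 chC Db Wb; last first.
  apply: (C_b _ C0); rewrite side_NtoV //= mul0r sub0r oppr_lt0.
  by rewrite !mulr_gt0 // add0r.
apply: (C_b _ Ca); rewrite side_toV // subr_gt0 /= /GRing.scale /= add0r.
have vm2 := norm1_pow_gt0 Nv v1_gt0 v2_gt0 m_gt0.
have vm1 : 0 < (v ^+ m).1.
  by have [vm1 _] := norm1_pow m Nv v1_gt0 v2_gt0; exact: lt_le_trans vm1.
have Nvm : qnorm (v ^+ m) = 1 by rewrite qnormX Nv expr1n.
have := mirror_order Nv v1_gt0 v2_gt0 nQ_gt0 Nvm vm1 vm2.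
rewrite -exprS -wm w1 w2 -!mulrA ltr_pM2l // => order.
rewrite -subr_gt0 [ltRHS](_ : _ = n%:R * c / alpha.1 *
    (alpha.2 * (1 + v.1) - alpha.1 * v.2)); last by field.
by apply: mulr_gt0; [rewrite divr_gt0 // mulr_gt0 | rewrite subr_gt0].
Qed.
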